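(* Let $\Psi_1,\Psi_2\subset\mathbb{R}^{n\times n}_+$ be compact (nonempty) sets of nonnegative matrices and assume that the semigroup $\mathcal{S}(\Psi_2)$ is irreducible. Then $$\mathrm{conv}_\otimes(\Psi_1)\subseteq\mathrm{int}_\otimes(\mathrm{conv}_\otimes(\Psi_2))\ \Longrightarrow\ \mu(\Psi_1)<\mu(\Psi_2).$$
   Context: $\mathbb{R}^{n\times n}_+$ is the set of $n\times n$ matrices with nonnegative real entries. Max-algebraic operations: $a\oplus b=\max\{a,b\}$ and $a\otimes b=ab$ on $\mathbb{R}_+$, extended to matrices by $(A\otimes B)_{ij}=\max_k a_{ik}b_{kj}$, with $A\oplus B$ the entrywise maximum. For $A\in\mathbb{R}^{n\times n}_+$, $\mu(A)=\max\{(a_{i_1i_2}a_{i_2i_3}\cdots a_{i_ki_1})^{1/k} \mid k\ge 1,\ 1\le i_1,\dots,i_k\le n \text{ distinct}\}$. For a bounded set $\Psi\subseteq\mathbb{R}^{n\times n}_+$ and $m\ge1$, $\Psi^m_\otimes=\{A_1\otimes\cdots\otimes A_m\mid A_j\in\Psi\}$, and $\Psi^0_\otimes=\{I\}$. The max-algebraic joint spectral radius is $\mu(\Psi)=\limsup_{m\to\infty}\left(\sup_{A\in\Psi^m_\otimes}\mu(A)\right)^{1/m}$, and the semigroup of $\Psi$ is $\mathcal{S}(\Psi)=\bigcup_{m\ge0}\Psi^m_\otimes$. For $M\subseteq\mathbb{R}^{n\times n}_+$, the max-convex hull is $\mathrm{conv}_\otimes(M)=\{\bigoplus_{i=1}^k\alpha_ix_i\mid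 k\in\mathbb{N},\ x_i\in M,\ \alpha_i\ge0,\ \bigoplus_{i=1}^k\alpha_i=1\}$ and the max cone spanned by $M$ is $\mathrm{span}_\otimes(M)=\{\bigoplus_{i=1}^k\alpha_ix_i\mid k\in\mathbb{N},\ x_i\in M,\ \alpha_i\ge0\}$. For a max-convex set $C\subseteq\mathbb{R}^{n\times n}_+$, $\mathrm{int}_\otimes(C)$ is the interior of $C$ in the topological space $\mathrm{span}_\otimes(C)$ with the relative (subspace) topology inherited from the usual topology of $\mathbb{R}^{n\times n}$. A matrix $A$ is irreducible if there is no non-trivial (that is, nonempty proper) subset $I\subset\{1,\dots,n\}$ with $a_{ij}=0$ for all $i\in I$, $j\notin I$. The semigroup $\mathcal{S}(\Psi)$ is irreducible if $\mathrm{conv}_\otimes(\Psi^m_\otimes)$ contains an irreducible matrix for some $m\ge0$.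
   Formalization: The formal theorem additionally assumes Ψ2 ≠ {0}: for n = 1 and Ψ1 = Ψ2 = {0} the semigroup is irreducible and the inclusion holds, but μ(Ψ1) = μ(Ψ2) = 0; for n ≥ 2 this assumption already follows from irreducibility. *)

(* Defs.v *)
From HB Require Import structures.
From mathcomp Require Import all_boot all_order all_algebra.
From mathcomp Require Import all_classical all_reals all_analysis.

Set Implicit Arguments.
Unset Strict Implicit.
Unset Printing Implicit Defensive.

Import Order.TTheory GRing.Theory Num.Theory.
Import numFieldNormedType.Exports.

Local Open Scope classical_set_scope.
Local Open Scope ring_scope.

Section MaxAlgebra.
Variables (R : realType) (n : nat).
Implicit Types (A B : 'M[R]_n) (M C Psi : set 'M[R]_n).

Definition nonneg_mx A := forall i j, 0 <= A i j.

(* On nonnegative data 0 is neutral for max, so it serves as the base value of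
   every iterated maximum below. *)
Definition maxadd A B : 'M[R]_n := map2_mx Num.max A B.

Definition maxmul A B : 'M[R]_n :=
  \matrix_(i, j) \big[Num.max/0]_k (A i k * B k j).

(* [ordS] is the cyclic successor, so the product includes the closing factor
   from the last index of [t] back to the first. *)
Definition cycle_weight A (k : nat) (t : k.-tuple 'I_n) : R :=
  \prod_(j < k) A (tnth t j) (tnth t (ordS j)).

(* Cycles of length k.+1; distinctness of the indices bounds the length by n. *)
Definition mu A : R :=
  \big[Num.max/0]_(k < n) \big[Num.max/0]_(t : k.+1.-tuple 'I_n | uniq t)
    cycle_weight A t `^ k.+1%:R^-1.

Definition maxpow Psi (m : nat) : set 'M[R]_n :=
  [set B | exists2 F : 'I_m -> 'M[R]_n,
     forall j, Psi (F j) & B = \big[maxmul/1%:M]_(j < m) F j].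

(* The term of index 0, where m%:R^-1 = 0, does not affect the limsup. *)
Definition max_jsr Psi : R :=
  limn_sup (fun m : nat => sup (mu @` maxpow Psi m) `^ m%:R^-1).

Definition max_conv M : set 'M[R]_n :=
  [set B | exists k (X : 'I_k -> 'M[R]_n) (a : 'I_k -> R),
     [/\ forall i, M (X i), forall i, 0 <= a i,
         \big[Num.max/0]_(i < k) a i = 1 &
         B = \big[maxadd/0]_(i < k) (a i *: X i)]].

Definition max_span M : set 'M[R]_n :=
  [set B | exists k (X : 'I_k -> 'M[R]_n) (a : 'I_k -> R),
     [/\ forall i, M (X i), forall i, 0 <= a i &
         B = \big[maxadd/0]_(i < k) (a i *: X i)]].

(* Points outside [max_span C] are isolated in [subspace (max_span C)]; this
   adds nothing to the interior since C is contained in [max_span C] for every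
   C of nonnegative matrices. *)
Definition max_int C : set 'M[R]_n :=
  interior (C : set (subspace (max_span C))).

Definition irreducible_mx A :=
  ~ exists I : {set 'I_n},
      (0 < #|I| < n)%N /\ forall i j, i \in I -> j \notin I -> A i j = 0.

Definition semigroup_irreducible Psi :=
  exists m : nat, exists2 A, max_conv (maxpow Psi m) A & irreducible_mx A.

End MaxAlgebra.

(* Main.v *)
Require Import Defs.
From HB Require Import structures.
From mathcomp Require Import all_boot all_order all_algebra.
From mathcomp Require Import all_classical all_reals all_analysis.
Import Order.TTheory GRing.Theory Num.Theory.
Import numFieldNormedType.Exports.
Local Open Scope classical_set_scope.
Local Open Scope ring_scope.

(* Since conv(Psi1) lies in the interior of conv(Psi2), compactness of Psi1
   yields a single r > 1 with r A in conv(Psi2) for all A in Psi1, so that each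
   entry of r A is at most the corresponding entry of some matrix of Psi2.
   This entrywise domination passes to max-products: each entry of r^N A, for A
   in Psi1^N, is at most that entry of some B in Psi2^N. The weight of a cycle
   of length k of A in Psi1^m is at most a diagonal entry of an element of
   Psi1^(mk), and the diagonal entries of elements of Psi2^N are at most
   mu(Psi2)^N (take powers), so r mu(Psi1) <= mu(Psi2). Irreducibility serves
   only to obtain mu(Psi2) > 0: following positive entries from an index, one
   eventually closes a cycle of positive weight. *)

(** * Bounds on a limsup from bounds on its terms *)

Section LimnSup.
Set Implicit Arguments.
Unset Strict Implicit.
Variables (R : realType) (u : R^nat) (c : R).
Hypotheses (u_ge0 : forall m, 0 <= u m) (u_le : forall m, (0 < m)%N -> u m <= c).

Let u_ub : has_ubound (range u).
Proof.
(* In [max_jsr] the term of index 0 has exponent 0 and equals 1, which c need not bound; hence the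
   separate treatment of [u 0]. *)
exists (Num.max (u 0) c) => _ [[|m] _ <-]; rewrite le_max ?lexx //.
by rewrite u_le // orbT.
Qed.

Let u_lb : has_lbound (range u).
Proof. by exists 0 => _ [m _ <-]. Qed.

Let sups_cvg : cvgn (sups u).
Proof. exact: (cvgP _ (cvg_sups_inf u_ub u_lb)). Qed.

Lemma limn_sup_le : limn_sup u <= c.
Proof.
apply: limr_le => //; exists 1%N => // m /= m_gt0.
apply: ge_sup; first by exists (u m), m => /=.
by move=> _ [p /= mp <-]; apply: u_le; exact: leq_trans mp.
Qed.

Lemma limn_sup_ge (d : R) :
  (forall m, exists2 p, (m <= p)%N & d <= u p) -> d <= limn_sup u.
Proof.
move=> d_le; apply: limr_ge => //; apply: nearW => m.
have [p mp /le_trans] := d_le m; apply.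
by apply: ub_le_sup; [exact: has_ubound_sdrop | exists p].
Qed.

End LimnSup.

Section MaxAlgebraTheory.
Set Implicit Arguments.
Unset Strict Implicit.
Variables (R : realType) (n : nat).
Implicit Types (A B C : 'M[R]_n) (Psi M : set 'M[R]_n).

(** * Max-products, powers and walks *)

Lemma maxmul_ge0 A B : nonneg_mx (maxmul A B).
Proof. by move=> i j; rewrite mxE; exact: bigmax_ge_id. Qed.

Lemma maxmul_ge A B i k j : A i k * B k j <= maxmul A B i j.
Proof. by rewrite mxE; exact: (le_bigmax _ (fun k => A i k * B k j)). Qed.

Lemma maxmul_attained A B i j : nonneg_mx A -> nonneg_mx B ->
  exists k, maxmul A B i j = A i k * B k j.
Proof.
move=> A_ge0 B_ge0; rewrite mxE.
have AB_ge0 k : predT k -> 0 <= A i k * B k j.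
  by move=> _; rewrite mulr_ge0 ?A_ge0 ?B_ge0.
by have [k _ ->] := eq_bigmax i predT _ isT AB_ge0; exists k.
Qed.

Lemma maxpow0 Psi : maxpow Psi 0 1%:M.
Proof.
by exists (fun=> 1%:M) => [[]//|]; rewrite big_ord0.
Qed.

Lemma maxpow0_eq Psi A : maxpow Psi 0 A -> A = 1%:M.
Proof. by case=> F _ ->; rewrite big_ord0. Qed.

Lemma maxpowS Psi m A B :
  Psi A -> maxpow Psi m B -> maxpow Psi m.+1 (maxmul A B).
Proof.
move=> PsiA [F PsiF ->].
exists (fun j => if unlift ord0 j is Some j' then F j' else A) => [j|].
  by case: unliftP.
rewrite big_ord_recl unlift_none; congr maxmul.
by apply: eq_bigr => j _; rewrite liftK.
Qed.

Lemma maxpowSP Psi m A : maxpow Psi m.+1 A ->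
  exists B C, [/\ Psi B, maxpow Psi m C & A = maxmul B C].
Proof.
case=> F PsiF ->; rewrite big_ord_recl.
by exists (F ord0), (\big[@maxmul R n/1%:M]_(j < m) F (lift ord0 j)); split=> //;
  exists (fun j => F (lift ord0 j)).
Qed.

Lemma maxpow_ge0 Psi m A : maxpow Psi m A -> forall i j, 0 <= A i j.
Proof.
case: m => [/maxpow0_eq -> i j|m /maxpowSP [B [C [_ _ ->]]]].
  by rewrite mxE ler0n.
exact: maxmul_ge0.
Qed.

Lemma maxpow1 Psi A : (forall B, Psi B -> nonneg_mx B) -> Psi A ->
  exists2 C, maxpow Psi 1 C & forall i j, A i j <= C i j.
Proof.
move=> Psi_ge0 PsiA; exists (maxmul A 1%:M).
  exact: maxpowS PsiA (maxpow0 _).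
by move=> i j; apply: le_trans (maxmul_ge _ _ _ j _); rewrite mxE eqxx mulr1.
Qed.

(** An entrywise inequality stands in for associativity of [maxmul]: it follows by induction on a,
    and walks need no more. *)
Lemma maxpowD Psi a b A B : (forall B, Psi B -> nonneg_mx B) ->
  maxpow Psi a A -> maxpow Psi b B ->
  exists2 C, maxpow Psi (a + b) C & forall i k j, A i k * B k j <= C i j.
Proof.
move=> Psi_ge0 + PsiB; elim: a A => [A /maxpow0_eq ->|a IHa A].
  exists B => // i k j; rewrite mxE; case: eqP => [->|_]; first by rewrite mul1r.
  by rewrite mul0r; exact: (maxpow_ge0 PsiB).
move=> /maxpowSP [A0 [A' [PsiA0 PsiA' ->]]].
have [C PsiC C_ge] := IHa _ PsiA'.
exists (maxmul A0 C) => [|i k j]; first exact: maxpowS.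
have [l ->] := maxmul_attained i k (Psi_ge0 _ PsiA0) (maxpow_ge0 PsiA').
apply: le_trans (maxmul_ge _ _ _ l _).
by rewrite -mulrA ler_wpM2l //; exact: Psi_ge0 PsiA0 _ _.
Qed.

(** The matrix may change at each step, so that [max_jsr_gt0] can pick one for every index visited;
    constant matrices give powers and cycles. *)
Lemma maxpow_walk Psi m (A : nat -> 'M[R]_n) (f : nat -> 'I_n) k :
  (forall B, Psi B -> nonneg_mx B) -> (forall j, maxpow Psi m (A j)) ->
  exists2 C, maxpow Psi (m * k) C &
    \prod_(j < k) A j (f j) (f j.+1) <= C (f 0%N) (f k).
Proof.
move=> Psi_ge0; elim: k A f => [|k IHk] A f PsiA.
  exists 1%:M; first by rewrite muln0; exact: maxpow0.
  by rewrite big_ord0 mxE eqxx.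
have [|C PsiC C_ge] := IHk (A \o succn) (f \o succn).
  by move=> j; exact: PsiA.
have [D PsiD D_ge] := maxpowD Psi_ge0 (PsiA 0%N) PsiC.
exists D; first by rewrite mulnS.
rewrite big_ord_recl /=; apply: le_trans (D_ge _ (f 1%N) _).
by rewrite ler_wpM2l //; exact: (maxpow_ge0 (PsiA 0%N)).
Qed.

Lemma maxpow_power Psi m A i k : (forall B, Psi B -> nonneg_mx B) ->
  maxpow Psi m A -> exists2 C, maxpow Psi (m * k) C & A i i ^+ k <= C i i.
Proof.
move=> Psi_ge0 PsiA.
have [//|C PsiC C_ge] :=
  @maxpow_walk Psi m (fun=> A) (fun=> i) k Psi_ge0.
by exists C => //; rewrite prodr_const card_ord in C_ge.
Qed.

(** * Cycle weights and [mu] *)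

Lemma cycle_weight_le Psi m A k (t : k.+1.-tuple 'I_n) :
  (forall B, Psi B -> nonneg_mx B) -> maxpow Psi m A ->
  exists2 C, maxpow Psi (m * k.+1) C &
    cycle_weight A t <= C (tnth t ord0) (tnth t ord0).
Proof.
(* Reduction modulo k.+1 turns the cycle into a walk that returns to its start at time k.+1, which
   accounts for the closing factor. *)
move=> Psi_ge0 PsiA; pose f j := tnth t (inord (j %% k.+1)).
have [//|C PsiC C_ge] := @maxpow_walk Psi m (fun=> A) f k.+1 Psi_ge0.
exists C => //.
have f0 : f 0%N = tnth t ord0.
  by congr tnth; apply: val_inj; rewrite /= inordK.
have fk : f k.+1 = tnth t ord0.
  by congr tnth; apply: val_inj; rewrite /= inordK modnn.
rewrite f0 fk in C_ge; apply: le_trans C_ge.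
rewrite le_eqVlt; apply/orP; left; apply/eqP; apply: eq_bigr => j _.
by congr (A _ _); rewrite /f; congr tnth; apply: val_inj;
  rewrite /= inordK ?ltn_mod // modn_small.
Qed.

Lemma cycle_weight_ge0 A k (t : k.-tuple 'I_n) :
  nonneg_mx A -> 0 <= cycle_weight A t.
Proof. by move=> A_ge0; apply: prodr_ge0. Qed.

Lemma mu_ge0 A : 0 <= mu A.
Proof. exact: bigmax_ge_id. Qed.

Lemma mu_ge_diag A i : nonneg_mx A -> A i i <= mu A.
Proof.
move=> A_ge0; have n_gt0 : (0 < n)%N by exact: leq_ltn_trans (ltn_ord i).
apply: (@bigmax_sup _ _ _ _ (Ordinal n_gt0)) => //.
apply: (@bigmax_sup _ _ _ _ [tuple i]) => //.
by rewrite /cycle_weight big_ord1 !ord1 !(tnth_nth i) /= invr1 powRr1.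
Qed.

Lemma mu_le A c : nonneg_mx A -> 0 <= c ->
  (forall k (t : k.+1.-tuple 'I_n), cycle_weight A t <= c ^+ k.+1) ->
  mu A <= c.
Proof.
move=> A_ge0 c_ge0 c_ge; apply: bigmax_le => // k _; apply: bigmax_le => // t _.
have -> : c = (c ^+ k.+1) `^ k.+1%:R^-1.
  by rewrite -powR_mulrn // -powRrM mulfV ?pnatr_eq0 // powRr1.
by apply: ge0_ler_powR => //; rewrite nnegrE ?exprn_ge0 // cycle_weight_ge0.
Qed.

(** * The joint spectral radius and diagonal entries of max-products *)

Section DiagonalBound.
Variables (Psi : set 'M[R]_n) (c : R).
Hypotheses (Psi_ge0 : forall A, Psi A -> nonneg_mx A) (Psi_neq0 : Psi !=set0).
Hypotheses (c_ge0 : 0 <= c)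
  (diag_le : forall m A i, (0 < m)%N -> maxpow Psi m A -> A i i <= c ^+ m).

Let s m := sup (@mu R n @` maxpow Psi m) `^ m%:R^-1.

Let mu_maxpow_le m A : (0 < m)%N -> maxpow Psi m A -> mu A <= c ^+ m.
Proof.
move=> m_gt0 PsiA; apply: mu_le; [exact: maxpow_ge0 PsiA|exact: exprn_ge0|].
move=> k t; have [C PsiC /le_trans] := cycle_weight_le t Psi_ge0 PsiA; apply.
by rewrite -exprM; apply: diag_le => //; rewrite muln_gt0 m_gt0.
Qed.

Let maxpow_neq0 m : maxpow Psi m !=set0.
Proof.
have [A PsiA] := Psi_neq0.
elim: m => [|m [B PsiB]]; first by exists 1%:M; exact: maxpow0.
by exists (maxmul A B); exact: maxpowS.
Qed.

Let s_le m : (0 < m)%N -> s m <= c.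
Proof.
move=> m_gt0; have mR : m%:R != 0 :> R by rewrite pnatr_eq0 -lt0n.
have -> : c = (c ^+ m) `^ m%:R^-1.
  by rewrite -powR_mulrn // -powRrM mulfV // powRr1.
have [A PsiA] := maxpow_neq0 m.
have ub : ubound (@mu R n @` maxpow Psi m) (c ^+ m).
  by move=> _ [B PsiB <-]; exact: mu_maxpow_le.
apply: ge0_ler_powR; rewrite ?nnegrE ?invr_ge0 ?exprn_ge0 //.
  by apply: le_trans (mu_ge0 A) _; apply: ub_le_sup; [exists (c ^+ m)|exists A].
by apply: ge_sup => //; exists (mu A), A.
Qed.

Lemma max_jsr_le : max_jsr Psi <= c.
Proof. by apply: limn_sup_le => // m; exact: powR_ge0. Qed.

Lemma max_jsr_ge0 : 0 <= max_jsr Psi.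
Proof.
apply: (limn_sup_ge (u := s) _ s_le) => [m|m]; first exact: powR_ge0.
by exists m => //; exact: powR_ge0.
Qed.

(** For every q > 0 some max-product of m * q factors has at least A i i ^ q at (i, i), so the term
    of index m * q is at least the m-th root of A i i. Such indices are unbounded. The a priori
    bound c keeps the suprema and the limsup finite. *)
Lemma maxpow_diag_le_jsr m A i :
  (0 < m)%N -> maxpow Psi m A -> A i i <= max_jsr Psi ^+ m.
Proof.
move=> m_gt0 PsiA; have A_ge0 := maxpow_ge0 PsiA i i.
have mR : m%:R != 0 :> R by rewrite pnatr_eq0 -lt0n.
have -> : A i i = (A i i `^ m%:R^-1) ^+ m.
  by rewrite -powR_mulrn ?powR_ge0 // -powRrM mulVf // powRr1.
rewrite ler_pXn2r ?nnegrE ?powR_ge0 ?max_jsr_ge0 //.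
apply: (limn_sup_ge (u := s) _ s_le) => [p|p]; first exact: powR_ge0.
exists (m * p.+1)%N; first by rewrite (leq_trans (leqnSn p)) // leq_pmull.
have [C PsiC C_ge] := maxpow_power i p.+1 Psi_ge0 PsiA.
have pR : p.+1%:R != 0 :> R by rewrite pnatr_eq0.
have -> : A i i `^ m%:R^-1 = (A i i ^+ p.+1) `^ (m * p.+1)%N%:R^-1.
  by rewrite -powR_mulrn // -powRrM natrM invfM mulrCA mulfV // mulr1.
have sup_ge : C i i <= sup (@mu R n @` maxpow Psi (m * p.+1)%N).
  apply: le_trans (mu_ge_diag i (maxpow_ge0 PsiC)) _.
  apply: ub_le_sup; last by exists C.
  exists (c ^+ (m * p.+1)%N) => _ [D PsiD <-].
  by apply: mu_maxpow_le => //; rewrite muln_gt0 m_gt0.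
apply: ge0_ler_powR; rewrite ?nnegrE ?invr_ge0 ?exprn_ge0 //.
  by apply: le_trans sup_ge; exact: (maxpow_ge0 PsiC).
exact: le_trans sup_ge.
Qed.

Lemma max_jsr_gt0 m : (0 < n)%N -> (0 < m)%N ->
  (forall i, exists j A, maxpow Psi m A /\ 0 < A i j) -> 0 < max_jsr Psi.
Proof.
move=> n_gt0 m_gt0 succ_ex.
have [f f_ex] := choice succ_ex; have [A A_gt0] := choice f_ex.
(* The orbit of an index under f is finite, so it enters a loop: a is the time of entry, p the
   length of the loop, and g runs along it. *)
have /trajectP [a lt_a eq_a] := looping_order f (Ordinal n_gt0).
set i0 := Ordinal n_gt0 in lt_a eq_a.
pose p := (order f i0 - a)%N; pose g j := iter (a + j) f i0.
have gS j : g j.+1 = f (g j) by rewrite /g addnS iterS.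
have gp : g p = g 0%N by rewrite /g /p addn0 subnKC ?(ltnW lt_a).
have p_gt0 : (0 < p)%N by rewrite subn_gt0.
have [C PsiC C_ge] := @maxpow_walk Psi m (A \o g) g p Psi_ge0
  (fun j => (A_gt0 (g j)).1).
have mp_gt0 : (0 < m * p)%N by rewrite muln_gt0 m_gt0.
have C_gt0 : 0 < C (g 0%N) (g 0%N).
  rewrite -[X in C _ X]gp; apply: lt_le_trans C_ge.
  by apply: prodr_gt0 => j _; rewrite gS; exact: (A_gt0 (g j)).2.
rewrite lt0r max_jsr_ge0 andbT; apply/eqP => jsr0.
have := lt_le_trans C_gt0 (maxpow_diag_le_jsr _ mp_gt0 PsiC).
by rewrite jsr0 expr0n eqn0Ngt mp_gt0 ltxx.
Qed.

End DiagonalBound.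

(** * Entrywise bounds and domination for max-products *)

Lemma compact_diag_bound Psi :
  (forall A, Psi A -> nonneg_mx A) -> compact Psi ->
  exists2 K : R, 0 <= K &
    forall m A i, (0 < m)%N -> maxpow Psi m A -> A i i <= K ^+ m.
Proof.
move=> Psi_ge0 /compact_bounded [K0 [_ K0_ge]].
(* The norm bound holds only for constants strictly above K0, and K0 may be negative. *)
pose K := Num.max (K0 + 1) 0; have K_ge0 : 0 <= K by rewrite le_max lexx orbT.
have A_le A i j : Psi A -> A i j <= K.
  move=> PsiA; have : `|A| <= K by apply: K0_ge => //; rewrite lt_max ltrDl ltr01.
  apply: le_trans; apply: le_trans (ler_norm _) _.
  rewrite [leRHS]mx_normrE.
  exact: (le_bigmax _ (fun ij : 'I_n * 'I_n => `|A ij.1 ij.2|) (i, j)).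
exists K => //.
(* An entry of a max-product is a single product of m entries, so K ^ m bounds it with no factor
   depending on n. *)
suff pow_le m A i j : maxpow Psi m A -> A i j <= K ^+ m.
  by move=> m A i _; exact: pow_le.
elim: m A i j => [|m IHm] A i j.
  by move=> /maxpow0_eq ->; rewrite mxE expr0; case: eqP.
move=> /maxpowSP [B [C [PsiB PsiC ->]]].
have [k ->] := maxmul_attained i j (Psi_ge0 _ PsiB) (maxpow_ge0 PsiC).
rewrite exprS ler_pM ?A_le ?IHm //; first exact: Psi_ge0 PsiB _ _.
exact: (maxpow_ge0 PsiC).
Qed.

(** The dominating C may depend on the entry, as it does in [max_conv_entry_le]. This is enough
    because one entry of a max-product is attained along one path, whose factors can be replaced
    separately. *)
Lemma maxpow_dominated Psi1 Psi2 r m A i j : 0 <= r ->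
  (forall B, Psi1 B -> nonneg_mx B) -> (forall B, Psi2 B -> nonneg_mx B) ->
  (forall B, Psi1 B -> forall i j, exists2 C, Psi2 C & r * B i j <= C i j) ->
  maxpow Psi1 m A -> exists2 C, maxpow Psi2 m C & r ^+ m * A i j <= C i j.
Proof.
move=> r_ge0 Psi1_ge0 Psi2_ge0 dom; elim: m A i j => [|m IHm] A i j.
  by move=> PsiA; exists 1%:M; [exact: maxpow0|rewrite (maxpow0_eq PsiA) mul1r].
move=> /maxpowSP [B [C [PsiB PsiC ->]]].
have [k ->] := maxmul_attained i j (Psi1_ge0 _ PsiB) (maxpow_ge0 PsiC).
have [B' PsiB' B'_ge] := dom _ PsiB i k; have [C' PsiC' C'_ge] := IHm _ k j PsiC.
exists (maxmul B' C'); first exact: maxpowS.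
apply: le_trans (maxmul_ge _ _ _ k _).
rewrite exprS mulrACA ler_pM // mulr_ge0 ?exprn_ge0 //; first exact: Psi1_ge0 PsiB _ _.
exact: (maxpow_ge0 PsiC).
Qed.

(** * Max-convex hulls and max cones *)

Lemma big_maxaddE k (X : 'I_k -> 'M[R]_n) i j :
  (\big[@maxadd R n/0]_(l < k) X l) i j = \big[Num.max/0]_(l < k) X l i j.
Proof.
by elim/big_rec2: _ => [|l x B _ <-]; rewrite !mxE.
Qed.

Lemma max_conv_entry_le M A i j : (forall B, M B -> nonneg_mx B) ->
  max_conv M A -> exists2 B, M B & A i j <= B i j.
Proof.
move=> M_ge0 [[|k] [X [a [MX a_ge0 a_max ->]]]].
  (* An empty combination has maximal coefficient 0, not 1. *)
  by move: a_max; rewrite big_ord0 => /esym/eqP; rewrite oner_eq0.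
rewrite big_maxaddE.
have aX_ge0 l : predT l -> 0 <= (a l *: X l) i j.
  by move=> _; rewrite mxE mulr_ge0 //; exact: M_ge0 (MX l) _ _.
have [l _ ->] := eq_bigmax ord0 predT _ isT aX_ge0.
exists (X l) => //; rewrite mxE ler_piMl //; first exact: M_ge0 (MX l) _ _.
by rewrite -a_max; exact: le_bigmax.
Qed.

Lemma max_conv_ge0 M A : max_conv M A -> nonneg_mx A.
Proof.
by move=> [k [X [a [_ _ _ ->]]]] i j; rewrite big_maxaddE bigmax_ge_id.
Qed.

Lemma scale_big_maxadd1 A r : nonneg_mx A -> 0 <= r ->
  r *: A = \big[@maxadd R n/0]_(l < 1) (r *: A).
Proof.
move=> A_ge0 r_ge0; apply/matrixP => i j.
rewrite big_maxaddE big_ord_recl big_ord0; apply/esym/max_idPl.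
by rewrite mxE mulr_ge0.
Qed.

Lemma max_convW M : (forall A, M A -> nonneg_mx A) -> M `<=` max_conv M.
Proof.
move=> M_ge0 A MA; exists 1%N, (fun=> A), (fun=> 1); split=> //.
  by rewrite big_ord_recl big_ord0; apply/max_idPl; exact: ler01.
by rewrite -scale_big_maxadd1 ?scale1r //; exact: M_ge0.
Qed.

Lemma max_spanZ M A r : (forall A, M A -> nonneg_mx A) -> M A -> 0 <= r ->
  max_span M (r *: A).
Proof.
move=> M_ge0 MA r_ge0; exists 1%N, (fun=> A), (fun=> r); split=> //.
by rewrite -scale_big_maxadd1 //; exact: M_ge0.
Qed.

(** * The relative interior and scaling *)

Lemma max_int_near M A : (forall B, M B -> nonneg_mx B) -> max_int M A ->
  M A /\ \forall B \near A, max_span M B -> M B.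
Proof.
move=> M_ge0 intA; have MA : M A by exact: interior_subset intA.
split=> //; have spanA : max_span M A.
  by rewrite -[A]scale1r; exact: max_spanZ.
move: intA; rewrite /max_int /interior /=.
(* Since A lies in the span, its neighbourhoods in the subspace are those of the ambient space
   restricted to the span. *)
change (nbhs_subspace (A : subspace (max_span M)) M ->
  \forall B \near A, max_span M B -> M B).
by rewrite -(nbhs_subspace_in spanA).
Qed.

(** As B tends to A and r decreases to 1, r *: B tends to A without leaving the span of M, so it
    ends up in M. Compactness, in its near-covering form, makes r uniform over Psi. *)
Lemma compact_max_int_scale Psi M : (forall B, M B -> nonneg_mx B) ->
  compact Psi -> Psi `<=` max_int M ->
  exists2 r, 1 < r & forall A, Psi A -> M (r *: A).
Proof.
move=> M_ge0 /compact_near_coveringP/near_covering_withinP cpt PsiM.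
suff near_scale : \forall r \near 1^'+, Psi `<=` [set A | M (r *: A)].
  have [r [r_gt1 r_scale]] :=
    filter_ex (filterI (@nbhs_right_gt R 1) near_scale).
  by exists r.
apply: cpt => A PsiA; have [MA nearA] := max_int_near M_ge0 (PsiM A PsiA).
pose F := filter_prod (nbhs A) (1 : R)^'+.
have F_filter : Filter F by exact: filter_prod_filter.
have scale_cvg : p.2 *: p.1 @[p --> F] --> A.
  rewrite -[X in _ --> X]scale1r; apply: cvgZ; [|exact: cvg_fst].
  by apply: cvg_trans; [exact: cvg_snd|exact: cvg_within].
have gt1 : \forall p \near F, 1 < p.2.
  exact: (@filter_prod2 _ _ (nbhs A) _ _ _ (nbhs_right_gt (1 : R))).
have near_MF : \forall p \near F, max_span M (p.2 *: p.1) -> M (p.2 *: p.1).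
  exact: (scale_cvg [set B | max_span M B -> M B]).
apply: filterS (filterI near_MF gt1) => -[B r] /= [near_scale r_gt1].
move=> /PsiM intB; apply: near_scale; apply: max_spanZ => //.
  exact: (max_int_near M_ge0 intB).1.
exact: ltW (lt_trans ltr01 r_gt1).
Qed.

(** * Positive entries from irreducibility *)

Lemma irreducible_succ Psi : (0 < n)%N -> (forall A, Psi A -> nonneg_mx A) ->
  semigroup_irreducible Psi -> Psi !=set0 -> Psi <> [set 0] ->
  exists2 m, (0 < m)%N & forall i, exists j A, maxpow Psi m A /\ 0 < A i j.
Proof.
move=> n_gt0 Psi_ge0 [m [A convA irrA]] Psi_neq0 Psi_neq_zero.
(* For n = 1 there is no non-trivial index set, so irreducibility says nothing; the positive entry
   comes from a nonzero matrix of Psi. *)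
case: (leqP n 1) => [n_le1|n_gt1].
  have [B PsiB B_neq0] : exists2 B, Psi B & B <> 0.
    apply: contrapT => Psi_eq0; apply: Psi_neq_zero; apply/seteqP.
    have Psi0 B : Psi B -> B = 0.
      by move=> PsiB; apply: contrapT => B_neq0; apply: Psi_eq0; exists B.
    split=> [B /Psi0 //|_ ->]; have [B PsiB] := Psi_neq0.
    by rewrite -(Psi0 _ PsiB).
  exists 1%N => // i; have [C PsiC C_ge] := maxpow1 Psi_ge0 PsiB.
  have all_i k : k = i.
    have ord_eq0 (l : 'I_n) : l = 0%N :> nat.
      by apply/eqP; rewrite -leqn0 -ltnS (leq_trans (ltn_ord l)).
    by apply: val_inj; rewrite /= !ord_eq0.
  exists i, C; split=> //; apply: lt_le_trans (C_ge i i).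
  rewrite lt0r (Psi_ge0 _ PsiB) andbT; apply/eqP => Bii0; apply: B_neq0.
  by apply/matrixP => k l; rewrite (all_i k) (all_i l) Bii0 mxE.
(* Irreducibility at the singleton of i yields a positive entry off the diagonal. Being off the
   diagonal, it also rules out m = 0, where only the identity occurs. *)
have succ i : exists j B, [/\ maxpow Psi m B, 0 < B i j & i != j].
  apply: contrapT => no_succ; apply: irrA; exists [set i]%SET.
  rewrite cards1 n_gt1; split=> // k j /set1P -> ij.
  apply: contrapT => /eqP Aij; apply: no_succ.
  have [B PsiB B_ge] := max_conv_entry_le i j (@maxpow_ge0 Psi m) convA.
  exists j, B; split=> //; last by move: ij; rewrite finset.in_set1 eq_sym.
  by apply: lt_le_trans B_ge; rewrite lt0r Aij (max_conv_ge0 convA).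
exists m => [|i]; last by have [j [B []]] := succ i; exists j, B.
rewrite lt0n; apply/eqP => m0; rewrite {}m0 in succ.
have [j [B [/maxpow0_eq -> + /negPf ij]]] := succ (Ordinal n_gt0).
by rewrite mxE ij ltxx.
Qed.

End MaxAlgebraTheory.

Theorem proposition6p1 (R : realType) (n : nat) (Psi1 Psi2 : set 'M[R]_n)
  (n_gt0 : (0 < n)%N)
  (Psi1_nonneg : forall A, Psi1 A -> nonneg_mx A)
  (Psi2_nonneg : forall A, Psi2 A -> nonneg_mx A)
  (Psi1_compact : compact Psi1) (Psi2_compact : compact Psi2)
  (Psi1_neq0 : Psi1 !=set0) (Psi2_neq0 : Psi2 !=set0)
  (Psi2_irr : semigroup_irreducible Psi2)
  (Psi2_neq_zero : Psi2 <> [set 0]) :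
  max_conv Psi1 `<=` max_int (max_conv Psi2) ->
  max_jsr Psi1 < max_jsr Psi2.
Proof.
move=> conv_sub.
have [K K_ge0 Psi2_diag] := compact_diag_bound Psi2_nonneg Psi2_compact.
have [r r_gt1 r_conv] :
    exists2 r, 1 < r & forall A, Psi1 A -> max_conv Psi2 (r *: A).
  apply: compact_max_int_scale => //; first exact: max_conv_ge0.
  by move=> A Psi1A; apply: conv_sub; exact: max_convW.
have r_gt0 : 0 < r by exact: lt_trans r_gt1.
have [m m_gt0 Psi2_succ] :=
  irreducible_succ n_gt0 Psi2_nonneg Psi2_irr Psi2_neq0 Psi2_neq_zero.
have jsr2_gt0 := max_jsr_gt0 Psi2_nonneg Psi2_neq0 K_ge0 Psi2_diag n_gt0 m_gt0
  Psi2_succ.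
(* Strictness comes from r > 1 and [max_jsr Psi2] > 0; the other inequality is [max_jsr_le] with c =
   [max_jsr Psi2 / r]. *)
apply: (@le_lt_trans _ _ (max_jsr Psi2 / r)); last first.
  by rewrite ltr_pdivrMr // ltr_pMr.
have jsr2_ge0 := ltW jsr2_gt0.
apply: max_jsr_le => // [|p A i p_gt0 Psi1A]; first exact: divr_ge0 (ltW r_gt0).
have dom : forall B, Psi1 B ->
    forall i j, exists2 C, Psi2 C & r * B i j <= C i j.
  move=> B Psi1B k j.
  have [C Psi2C] := max_conv_entry_le k j Psi2_nonneg (r_conv _ Psi1B).
  by rewrite mxE; exists C.
have [C Psi2C /le_trans C_ge] :=
  maxpow_dominated i i (ltW r_gt0) Psi1_nonneg Psi2_nonneg dom Psi1A.
rewrite expr_div_n ler_pdivlMr ?exprn_gt0 // mulrC; apply: C_ge.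
exact: (maxpow_diag_le_jsr Psi2_nonneg Psi2_neq0 K_ge0 Psi2_diag i p_gt0 Psi2C).
Qed.
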